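(* Fix integers $k\ge 2$ and $\delta$ with $k\le\delta\le 2k-1$, and set $h=\delta-k$. There exists an integer $n_{\mathrm{int}}(k,\delta)\ge 2\delta+2$ such that for every integer $n\ge n_{\mathrm{int}}(k,\delta)$ there is a graph $G^{\min}_{h,k,n}\in\mathcal{L}_{\mathcal{H}}^{2}(n,k,\delta)$ such that every $G\in\mathcal{L}_{\mathcal{H}}^{2}(n,k,\delta)$ satisfies $$\rho(G)\ge\rho\bigl(G^{\min}_{h,k,n}\bigr),$$ with equality if and only if $G\cong G^{\min}_{h,k,n}$. Consequently $G^{\min}_{h,k,n}$ is the unique minimizer of $\rho$ over $\mathcal{L}_{\mathcal{H}}^{2}(n,k,\delta)$ up to isomorphism. If $h=0$, then $G^{\min}_{0,k,n}\cong G^\star_{0,k,n}$, where $G^\star_{0,k,n}$ is the unique (up to isomorphism) member of $\mathcal{L}_{\mathcal{H}}^{2}(n,k,k)$. If $h\ge 1$, then the missing-edge graph of $G^{\min}_{h,k,n}$ is isomorphic to $hK_2\cup 2K_1$, and the $Y$-endpoints of its $2h$ exceptional $X$--$Y$ edges are pairwise distinct.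
   Context: All graphs are finite, simple and undirected; $\rho(G)$ denotes the adjacency spectral radius of $G$. Write $h=\delta-k$, so $0\le h\le k-1$. Family $\mathcal{L}_{\mathcal{H}}^{2}(n,k,\delta)$: it consists of all graphs $G$ (up to isomorphism) obtained as follows. Take pairwise disjoint vertex sets $X,W,Y$ with $|X|=2h+2$, $|W|=k-h-1$, $|Y|=n-k-h-1$. Choose a connected graph $H$ with vertex set $X$ and exactly $\binom{2h+2}{2}-h$ edges. Start from the graph $K_W\vee(H\cup K_Y)$, where $K_W,K_Y$ are the complete graphs on $W,Y$ ($K_\varnothing$ is the empty graph), $\cup$ is disjoint union and $\vee$ is the graph join. Then add a set $B$ of exactly $2h$ edges (the exceptional $X$--$Y$ edges), each joining a vertex of $X$ to a vertex of $Y$, in such a way that every vertex of $X$ has degree at least $\delta$ in the resulting graph $G$. The missing-edge graph $M$ of such a graph is the graph on vertex set $X$ with $E(M)=E(K_X)\setminus E(H)$. $hK_2\cup 2K_1$ denotes the disjoint union of $h$ single edges and two isolated vertices. *)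

(* Defs.v *)
From HB Require Import structures.
From mathcomp Require Import all_boot all_order all_algebra.
From mathcomp Require Import complex.
From mathcomp Require Import boolp classical_sets reals.

Set Implicit Arguments.
Unset Strict Implicit.
Unset Printing Implicit Defensive.

Record sgraph := SGraph {
  vertex :> finType;
  adj : rel vertex;
  adj_sym : symmetric adj;
  adj_irr : irreflexive adj
}.

Definition edges (G : sgraph) : {set {set G}} :=
  [set e : {set G} | [exists x, exists y, adj x y && (e == [set x; y]%SET)]]%SET.

Definition degree (G : sgraph) (x : G) : nat := #|[pred y | adj x y]|.

Definition graph_connected (G : sgraph) : Prop := forall x y : G, connect (@adj G) x y.

Definition iso (G1 G2 : sgraph) : Prop :=
  exists2 f : G1 -> G2, bijective f & forall x y, adj (f x) (f y) = adj x y.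

Section Constructions.
Variables (T : finType) (n : nat) (G1 G2 : sgraph).

Definition complete_adj : rel T := fun x y => x != y.

Fact complete_sym : symmetric complete_adj.
Proof. by move=> x y; rewrite /complete_adj eq_sym. Qed.

Fact complete_irr : irreflexive complete_adj.
Proof. by move=> x; rewrite /complete_adj eqxx. Qed.

Definition complete_graph := SGraph complete_sym complete_irr.

Definition compl_adj : rel G1 := fun x y => (x != y) && ~~ adj x y.

Fact compl_sym : symmetric compl_adj.
Proof. by move=> x y; rewrite /compl_adj eq_sym adj_sym. Qed.

Fact compl_irr : irreflexive compl_adj.
Proof. by move=> x; rewrite /compl_adj eqxx. Qed.

Definition graph_compl := SGraph compl_sym compl_irr.

Definition sum_adj (b : bool) : rel (G1 + G2)%type := fun u v =>
  match u, v with
  | inl x, inl y => adj x y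
  | inr x, inr y => adj x y
  | _, _ => b
  end.

Fact sum_sym b : symmetric (sum_adj b).
Proof. by case=> x [] y //=; rewrite adj_sym. Qed.

Fact sum_irr b : irreflexive (sum_adj b).
Proof. by case=> x /=; rewrite adj_irr. Qed.

Definition graph_union := SGraph (sum_sym false) (sum_irr false).

Definition graph_join := SGraph (sum_sym true) (sum_irr true).

Definition copies_adj : rel ('I_n * G1)%type := fun u v =>
  (u.1 == v.1) && adj u.2 v.2.

Fact copies_sym : symmetric copies_adj.
Proof. by move=> u v; rewrite /copies_adj eq_sym adj_sym. Qed.

Fact copies_irr : irreflexive copies_adj.
Proof. by move=> u; rewrite /copies_adj adj_irr andbF. Qed.

Definition graph_copies := SGraph copies_sym copies_irr.

End Constructions.

(* The disjoint union of h copies of K_2 and two isolated vertices. *)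
Definition hK2_2K1 (h : nat) : sgraph :=
  graph_union (graph_copies h (complete_graph 'I_2))
              (graph_copies 2 (complete_graph 'I_1)).

Section Family.
Variables (n k h : nat) (H : sgraph).

Notation W := 'I_(k - h - 1).
Notation Y := 'I_(n - k - h - 1).

(* The vertex set is W + (X + Y), where X is the vertex set of H. *)
Definition base_graph : sgraph :=
  graph_join (complete_graph W) (graph_union H (complete_graph Y)).

(* A set of X--Y edges is given by the corresponding set of pairs (x, y). *)
Definition cross (B : {set H * Y}) : rel base_graph := fun u v =>
  match u, v with
  | inr (inl x), inr (inr y) => (x, y) \in B
  | inr (inr y), inr (inl x) => (x, y) \in B
  | _, _ => false
  end.

Definition L2_adj (B : {set H * Y}) : rel base_graph :=
  fun u v => adj u v || cross B u v.

Fact L2_sym B : symmetric (L2_adj B).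
Proof.
move=> u v; rewrite /L2_adj adj_sym; congr (_ || _).
by move: u v => [u|[u|u]] [v|[v|v]].
Qed.

Fact L2_irr B : irreflexive (L2_adj B).
Proof. by move=> u; rewrite /L2_adj adj_irr; case: u => [u|[u|u]]. Qed.

Definition L2_graph (B : {set H * Y}) : sgraph := SGraph (L2_sym B) (@L2_irr B).

Definition X_vertex (B : {set H * Y}) (x : H) : L2_graph B := inr (inl x).

End Family.

Arguments L2_graph n k h {H} B.
Arguments X_vertex n k h {H} B x.

(* The pairs (H, B) allowed in the construction, with h = delta - k. *)
Definition L2_data (n k delta : nat) (H : sgraph)
    (B : {set H * 'I_(n - k - (delta - k) - 1)}) : Prop :=
  let h := delta - k in
  [/\ #|H| = 2 * h + 2, graph_connected H, #|edges H| = 'C(2 * h + 2, 2) - h,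
      #|B| = 2 * h
    & forall x : H, delta <= degree (X_vertex n k h B x)].

Arguments L2_data n k delta {H} B.

Definition L2 (n k delta : nat) (G : sgraph) : Prop :=
  exists (H : sgraph) (B : {set H * 'I_(n - k - (delta - k) - 1)}),
    L2_data n k delta B /\ iso G (L2_graph n k (delta - k) B).

Section SpectralRadius.
Local Open Scope ring_scope.
Local Open Scope classical_set_scope.

Definition adjmx (K : nzRingType) (G : sgraph) : 'M[K]_#|G| :=
  \matrix_(i, j) (adj (enum_val i) (enum_val j))%:R.

(* The largest modulus of a complex eigenvalue of the adjacency matrix; on
   R[i] the norm takes its values in R[i], whence the projection Re. *)
Definition rho (R : realType) (G : sgraph) : R :=
  sup [set complex.Re `|z| | z in [set z : R[i] | eigenvalue (adjmx _ G) z]].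

End SpectralRadius.

(* Main.v *)
Require Import Defs.
From mathcomp Require Import all_boot all_order all_algebra.
From mathcomp Require Import reals spectral complex.
From mathcomp Require Import ring lra zify.

(** Counting degrees, a vertex [x] of [X] with [d x] missing edges must receive
    exactly [d x] exceptional edges, because both quantities sum to [2 h]
    ([L2_degrees]). A member is therefore a missing-edge graph with [h] edges
    together with a choice of [Y]-ends. All members share the clique on
    [W + Y], of size [N], and [x] has [c x = (k - h - 1) + d x] neighbours in it.

    The exceptional edges and the join with [W] raise the spectral radius above
    [N - 1], the value of the clique alone, and to first order the gain is
    [s / N ^ 2] with [s] the sum of the [c x ^ 2]: the explicit vectors of
    [rho_lower_bound] and [rho_upper_bound] give
    [N - 1 + s / N ^ 2 <= rho <= N - 1 + (s + 1) / N ^ 2] for large [N]. As the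
    [d x] have a fixed sum, [s] is least exactly when every [d x] is at most one,
    that is when the missing edges form a matching, and otherwise [s] is larger
    by at least two ([strict_of_not_matching]).

    Among matchings [s] does not depend on the choice of [Y]-ends, and an exact
    argument takes over. If the [2 h] ends are distinct
    the graph is determined up to isomorphism ([min_graph_iso]), and its top
    eigenvector takes only five values ([min_graph_quotient]). Placed on a graph
    where two exceptional edges share an end, these values have the same Rayleigh
    quotient but are not an eigenvector, so that graph has a strictly larger
    spectral radius ([strict_of_collision]).

    Hence every member either exceeds the candidate strictly or is isomorphic to
    it ([strict_or_minimal]), and the assertions follow since [rho] is invariant
    under isomorphism. *)

Set Implicit Arguments.
Unset Strict Implicit.
Unset Printing Implicit Defensive.

Import Order.TTheory GRing.Theory Num.Theory.

(** * The spectral radius as a maximal Rayleigh quotient *)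

Section SpectralTheorem.
Local Open Scope ring_scope.
Local Open Scope sesquilinear_scope.

(** Diagonalize [A] in a unitary basis: the Rayleigh quotient becomes a weighted
    mean of the real eigenvalues, so the largest of them bounds it and is
    attained on its own row of the diagonalizing matrix. *)
Lemma realsym_top_eigen (C : numClosedFieldType) n (A : 'M[C]_n) (i00 : 'I_n) :
  (forall i j, A i j = A j i) -> (forall i j, A i j \is Num.real) ->
  exists mu : C, [/\ mu \is Num.real,
    exists2 v : 'rV[C]_n, v != 0 & v *m A = mu *: v &
    forall y : 'rV[C]_n,
      \sum_i \sum_j y 0 i * A i j * (y 0 j)^* <= mu * \sum_i `|y 0 i| ^+ 2].
Proof.
move=> Asym Areal.
have Aherm : A \is hermsymmx.
  apply: realsym_hermsym; last by apply/mxOverP.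
  by apply/is_hermitianmxP; rewrite expr0 scale1r map_mx_id //; apply/matrixP=> i j; rewrite mxE.
have dreal := hermitian_spectral_diag_real Aherm.
set d := spectral_diag A in dreal.
set P := spectralmx A.
have Pu : P \is unitarymx by apply: spectral_unitarymx.
have /orthomx_spectralP AE : A \is normalmx by apply: hermitian_normalmx.
rewrite -/P -/d invmx_unitary // in AE.
have dr i : d 0 i \is Num.real by move/mxOverP: dreal.
have [i0 _ i0max] := @real_arg_maxP C _ i00 xpredT (d 0) isT (fun i _ => dr i).
exists (d 0 i0); split=> //.
  exists (row i0 P).
    apply/eqP=> /(congr1 (mulmx^~ (P^t*))).
    rewrite -row_mul (unitarymxP Pu) mul0mx => /matrixP/(_ 0 i0).
    by rewrite !mxE eqxx => /eqP; rewrite oner_eq0.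
  rewrite AE mulmxA mulmxA -row_mul (unitarymxP Pu).
  by rewrite -row_mul mul1mx row_diag_mx -scalemxAl -rowE.
move=> y; pose u := y *m P^t*.
have -> : \sum_i \sum_j y 0 i * A i j * (y 0 j)^* = (y *m A *m y^t*) 0 0.
  rewrite exchange_big mxE; apply: eq_bigr => j _; rewrite !mxE mulr_suml.
  by apply: eq_bigr.
have nE (m : nat) (z : 'rV[C]_m) : \sum_i `|z 0 i| ^+ 2 = (z *m z^t*) 0 0.
  by rewrite mxE; apply: eq_bigr => i _; rewrite !mxE normCK.
rewrite (_ : y *m A *m y^t* = u *m diag_mx d *m u^t*); last first.
  by rewrite AE /u trmx_mul map_mxM trmxCK !mulmxA.
have -> : \sum_i `|y 0 i| ^+ 2 = \sum_i `|u 0 i| ^+ 2.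
  by rewrite !nE /u trmx_mul map_mxM trmxCK mulmxA mulmxKtV // trmx_unitary conjC_unitary.
rewrite mulr_sumr mxE; apply: ler_sum => i _.
rewrite mul_mx_diag !mxE mulrAC -normCK mulrC ler_wpM2r ?exprn_ge0 //.
exact: i0max.
Qed.

End SpectralTheorem.

Section Rayleigh.
Local Open Scope ring_scope.
Variables (R : realType) (G : sgraph).
Implicit Types y z : G -> R.

Definition nbr_sum z v : R := \sum_u (adj v u)%:R * z u.
Definition sqnorm z : R := \sum_v z v ^+ 2.
Definition qform z : R := \sum_v z v * nbr_sum z v.

Lemma nbr_sum_sym y z : \sum_v y v * nbr_sum z v = \sum_v z v * nbr_sum y v.
Proof.
under eq_bigr do rewrite mulr_sumr; rewrite exchange_big /=.
apply: eq_bigr => u _; rewrite mulr_sumr; apply: eq_bigr => v _.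
by rewrite adj_sym; ring.
Qed.

Lemma nbr_sumDZ y z e v :
  nbr_sum (fun u => y u + e * z u) v = nbr_sum y v + e * nbr_sum z v.
Proof. by rewrite /nbr_sum mulr_sumr -big_split; apply: eq_bigr => u _ /=; ring. Qed.

(** A maximizer of the Rayleigh quotient is critical: moving it along the
    residual [g = A z - mu z] changes [mu |z|^2 - q z] by
    [- 2 e |g|^2 + O(e^2)], and nonnegativity for small [e > 0] forces [g = 0]. *)
Lemma rayleigh_max_eigen (mu : R) z :
  (forall y, qform y <= mu * sqnorm y) -> qform z = mu * sqnorm z ->
  forall v, nbr_sum z v = mu * z v.
Proof.
move=> qle qz.
pose g v := nbr_sum z v - mu * z v.
have sg : sqnorm g = \sum_v g v * nbr_sum z v - mu * \sum_v g v * z v.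
  by rewrite mulr_sumr -sumrB; apply: eq_bigr => v _; rewrite /g; ring.
have expand e : 2 * e * sqnorm g <= e ^+ 2 * (mu * sqnorm g - qform g).
  have := qle (fun v => z v + e * g v).
  have -> : qform (fun v => z v + e * g v) =
      qform z + 2 * e * (\sum_v g v * nbr_sum z v) + e ^+ 2 * qform g.
    rewrite {1}/qform; under eq_bigr do rewrite nbr_sumDZ.
    have -> : 2 * e * (\sum_v g v * nbr_sum z v) =
        e * (\sum_v g v * nbr_sum z v) + e * (\sum_v z v * nbr_sum g v).
      by rewrite (nbr_sum_sym z g); ring.
    rewrite /qform !mulr_sumr -!big_split; apply: eq_bigr => v _ /=; ring.
  have -> : sqnorm (fun v => z v + e * g v) =
      sqnorm z + 2 * e * (\sum_v g v * z v) + e ^+ 2 * sqnorm g.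
    by rewrite /sqnorm !mulr_sumr -!big_split; apply: eq_bigr => v _ /=; ring.
  rewrite qz {2}sg; lra.
have g0 : sqnorm g = 0.
  have S0 : 0 <= sqnorm g by apply: sumr_ge0 => v _; apply: sqr_ge0.
  have D0 : 0 <= mu * sqnorm g - qform g by rewrite subr_ge0 qle.
  move: (mu * sqnorm g - qform g) D0 expand => D D0 expand.
  apply/eqP; rewrite eq_le S0 andbT leNgt; apply/negP => Spos.
  (* With e = |g|^2 / (D + 1) the inequality becomes 2 |g|^4 (D + 1) <= |g|^4 D. *)
  have D1 : 0 < D + 1 by lra.
  have := expand (sqnorm g / (D + 1)); rewrite -(ler_pM2r (exprn_gt0 2 D1)).
  rewrite [X in X <= _](_ : _ = 2 * (D + 1) * sqnorm g ^+ 2); last by field; lra.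
  rewrite [X in _ <= X](_ : _ = sqnorm g ^+ 2 * D); last by field; lra.
  have := exprn_gt0 2 Spos; nra.
move=> v; apply/eqP; rewrite -subr_eq0 -[_ - _]/(g v) -sqrf_eq0; apply/eqP.
move: v isT; apply/psumr_eq0P=> // v _; exact: sqr_ge0.
Qed.

Lemma sum_enum_val (V : nmodType) (T : finType) (F : T -> V) :
  \sum_(i < #|T|) F (enum_val i) = \sum_v F v.
Proof. by rewrite -big_enum_val. Qed.

(** All later arguments use [rho] only through these facts: it bounds every real
    Rayleigh quotient, and it is attained by a nonnegative eigenvector. The
    entrywise absolute value of an eigenvector for the largest eigenvalue has at
    least the same Rayleigh quotient because the entries of [A] are nonnegative;
    the same remark, applied to complex eigenvectors, shows that no eigenvalue
    has a larger modulus. *)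
Lemma rho_spectral (v0 : G) :
  [/\ forall y, qform y <= rho R G * sqnorm y,
      exists z, [/\ forall v, 0 <= z v, exists v, z v != 0
                  & forall v, nbr_sum z v = rho R G * z v]
    & 0 <= rho R G].
Proof.
pose A := adjmx R[i] G.
have AE i j : A i j = (real_complex R) (adj (enum_val i) (enum_val j))%:R.
  by rewrite mxE rmorph_nat.
have Asym i j : A i j = A j i by rewrite !AE adj_sym.
have Areal i j : A i j \is Num.real by rewrite mxE realn.
have [mu' [mur [v vn0 vE] rayC]] := realsym_top_eigen (enum_rank v0) Asym Areal.
have /complex_realP [mu muE] := mur; rewrite {}muE in vE rayC * => {mur}.
have toC (F : G -> R) : (\sum_v F v)%:C%C = \sum_(i < #|G|) (F (enum_val i))%:C%C.
  rewrite (sum_enum_val (fun v => (F v)%:C%C)); exact: (rmorph_sum (real_complex R)).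
have ray y : qform y <= mu * sqnorm y.
  have := rayC (\row_(i < #|G|) (y (enum_val i))%:C%C).
  have -> : \sum_i `|(\row_(i < #|G|) (y (enum_val i))%:C%C) 0 i| ^+ 2 = (sqnorm y)%:C%C.
    rewrite /sqnorm toC; apply: eq_bigr => i _; rewrite mxE rmorphXn.
    by rewrite normc_def /= expr0n addr0 sqrtr_sqr -!rmorphXn /= real_normK // num_real.
  rewrite -rmorphM /= -lecR; congr (_ <= _).
  apply: etrans (esym (toC (fun v => y v * nbr_sum y v))); apply: eq_bigr => i _.
  rewrite -[RHS]/(real_complex R (_ * _)) rmorphM /= /nbr_sum toC mulr_sumr; apply: eq_bigr => j _.
  rewrite !mxE rmorphM rmorph_nat /= mulrA; congr (_ * _); exact: conjc_real.
(* The matrix and mu are real, so a nonzero real or imaginary part does. *)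
have eig : exists2 x : G -> R, (exists u, x u != 0) & forall u, nbr_sum x u = mu * x u.
  have vE' u : \sum_w (adj u w)%:R%:C%C * v 0 (enum_rank w) = mu%:C%C * v 0 (enum_rank u).
    have /matrixP/(_ 0 (enum_rank u)) := vE; rewrite !mxE => <-.
    rewrite -sum_enum_val; apply: eq_bigr => i _.
    by rewrite enum_valK AE enum_rankK adj_sym mulrC.
  have eig (f : R[i] -> R) : f 0 = 0 -> {morph f : a b / a + b} ->
      (forall (r : R) a, f (r%:C%C * a) = r * f a) ->
      forall u, nbr_sum (fun w => f (v 0 (enum_rank w))) u = mu * f (v 0 (enum_rank u)).
    move=> f0 fD fZ u; rewrite -fZ -vE' (big_morph f fD f0).
    by apply: eq_bigr => w _; rewrite fZ.
  have [j vj] : exists j, v 0 j != 0 by apply/rV0Pn.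
  have [/eqP re0|re0] := boolP (complex.Re (v 0 j) == 0).
    exists (fun w => complex.Im (v 0 (enum_rank w))).
      exists (enum_val j); rewrite enum_valK; apply: contra vj => /eqP im0.
      by rewrite [v 0 j]complexE re0 im0 mulr0 addr0.
    by apply: eig => [|[? ?] [? ?]|r [? ?]] //=; rewrite mul0r addr0.
  exists (fun w => complex.Re (v 0 (enum_rank w))).
    by exists (enum_val j); rewrite enum_valK.
  by apply: eig => [|[? ?] [? ?]|r [? ?]] //=; rewrite mul0r subr0.
have {eig} [x [u0 xu0] xE] := eig.
have nxq y : qform y <= qform (fun u => `|y u|).
  apply: ler_sum => u _; rewrite /nbr_sum !mulr_sumr; apply: ler_sum => w _.
  rewrite !mulrA ![_ * _%:R]mulrC -!mulrA ler_wpM2l // -normrM; exact: ler_norm.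
have nxn y : sqnorm (fun u => `|y u|) = sqnorm y.
  by apply: eq_bigr => u _; rewrite real_normK // num_real.
have absE u : nbr_sum (fun u => `|x u|) u = mu * `|x u|.
  apply: (rayleigh_max_eigen ray); apply/eqP; rewrite eq_le ray nxn /=.
  apply: le_trans (nxq _); rewrite /qform mulr_sumr le_eqVlt; apply/orP; left.
  by apply/eqP; apply: eq_bigr => w _; rewrite xE; ring.
have mu_ge0 : 0 <= mu.
  have := ray (fun=> 1); rewrite /qform /sqnorm => le1.
  have q0 : 0 <= \sum_(w : G) 1 * nbr_sum (fun=> 1) w.
    by apply: sumr_ge0 => w _; rewrite mul1r; apply: sumr_ge0 => t _; rewrite mulr1.
  have n0 : 0 < \sum_(w : G) (1 : R) ^+ 2.
    rewrite (bigD1 v0) //= expr1n ltr_pwDl // sumr_ge0 // => w _; exact: sqr_ge0.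
  by rewrite -(pmulr_lge0 mu n0); apply: le_trans q0 le1.
suff rhoE : rho R G = mu.
  rewrite rhoE; split=> //; exists (fun u => `|x u|); split=> //.
  by exists u0; rewrite normr_eq0.
(* Moduli of an eigenvector for z form a real vector y with |z| y <= A y. *)
have norm_le (z : R[i]) : eigenvalue A z -> complex.Re `|z| <= mu.
  case/eigenvalueP=> t tE tn0.
  pose y u := complex.Re `|t 0 (enum_rank u)|.
  have yE u : (y u)%:C%C = `|t 0 (enum_rank u)| by rewrite RRe_real // normr_real.
  have tE' u : \sum_w (adj u w)%:R%:C%C * t 0 (enum_rank w) = z * t 0 (enum_rank u).
    have /matrixP/(_ 0 (enum_rank u)) := tE; rewrite !mxE => <-.
    rewrite -sum_enum_val; apply: eq_bigr => i _.
    by rewrite enum_valK AE enum_rankK adj_sym mulrC.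
  have y0 u : 0 <= y u by rewrite -ler0c yE.
  have yle u : complex.Re `|z| * y u <= nbr_sum y u.
    have zyE : (complex.Re `|z| * y u)%:C%C = `|z * t 0 (enum_rank u)|.
      by rewrite normrM -yE -[in RHS](RRe_real (normr_real z)) -rmorphM.
    rewrite -lecR zyE -tE'.
    apply: le_trans (ler_norm_sum _ _ _) _.
    rewrite /nbr_sum toC -(sum_enum_val (fun w => `|_ * t 0 (enum_rank w)|)).
    apply: ler_sum => i _; rewrite normrM -yE rmorphM /= ler_wpM2r ?ler0c //.
    by case: (adj u (enum_val i)); rewrite ?normr1 ?normr0.
  have n0 : 0 < sqnorm y.
    have [j tj] : exists j, t 0 j != 0 by apply/rV0Pn.
    rewrite /sqnorm (bigD1 (enum_val j)) //= ltr_pwDl //; last first.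
      by apply: sumr_ge0 => w _; exact: sqr_ge0.
    by rewrite exprn_gt0 // -ltcR yE enum_valK normr_gt0.
  rewrite -(ler_pM2r n0); apply: le_trans (ray y).
  rewrite /sqnorm /qform mulr_sumr; apply: ler_sum => u _.
  by rewrite expr2 mulrCA ler_wpM2l.
have mu_eig : eigenvalue A mu%:C%C by apply/eigenvalueP; exists v.
have muN : complex.Re `|mu%:C%C| = mu.
  by rewrite normc_def /= expr0n addr0 sqrtr_sqr ger0_norm.
apply/eqP; rewrite eq_le; apply/andP; split.
  apply: sup_le_ub => [|_ [z zA <-]]; last exact: norm_le.
  by exists mu, mu%:C%C.
apply: ub_le_sup; first by exists mu => _ [z zA <-]; exact: norm_le.
by exists mu%:C%C.
Qed.
End Rayleigh.

Lemma iso_sym G1 G2 : iso G1 G2 -> iso G2 G1.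
Proof.
move=> [f [g fK gK] fE]; exists g; first by exists f.
by move=> x y; rewrite -fE !gK.
Qed.

Lemma iso_trans G1 G2 G3 : iso G1 G2 -> iso G2 G3 -> iso G1 G3.
Proof.
move=> [f fb fE] [g gb gE]; exists (g \o f); first exact: bij_comp.
by move=> x y /=; rewrite gE fE.
Qed.

Section RhoBounds.
Local Open Scope ring_scope.
Variables (R : realType) (G : sgraph).
Implicit Types (y z : G -> R).

Lemma sqnorm_gt0 y v : y v != 0 -> 0 < sqnorm y.
Proof.
move=> yv; rewrite /sqnorm (bigD1 v) //= ltr_pwDl ?exprn_even_gt0 //.
by apply: sumr_ge0 => w _; exact: sqr_ge0.
Qed.

Lemma rho_ge_rayleigh y v (t : R) : y v != 0 -> t * sqnorm y <= qform y -> t <= rho R G.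
Proof.
move=> yv lt_tq; have [ray _ _] := rho_spectral R v.
rewrite -(ler_pM2r (sqnorm_gt0 yv)); exact: le_trans (ray y).
Qed.

(** Pair the supersolution with the nonnegative top eigenvector [z]: symmetry
    turns [rho <y, z>] into [<A y, z> <= t <y, z>], and [<y, z> > 0]. *)
Lemma rho_le_supersolution (v0 : G) y (t : R) : (forall v, 0 < y v) ->
  (forall v, nbr_sum y v <= t * y v) -> rho R G <= t.
Proof.
move=> ypos yle; have [_ [z [z0 [v zv] zE]] _] := rho_spectral R v0.
have S0 : 0 < \sum_v y v * z v.
  rewrite (bigD1 v) //= ltr_pwDl ?mulr_gt0 // ?lt0r ?zv //=.
  by apply: sumr_ge0 => w _; rewrite mulr_ge0 // ltW.
rewrite -(ler_pM2r S0) !mulr_sumr.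
have -> : \sum_i rho R G * (y i * z i) = \sum_i z i * nbr_sum y i.
  by rewrite nbr_sum_sym; apply: eq_bigr => w _; rewrite zE; ring.
apply: ler_sum => w _; rewrite mulrA [X in _ <= X]mulrC ler_wpM2l //.
Qed.

End RhoBounds.

Section RhoIso.
Local Open Scope ring_scope.

Lemma rho_iso_le (R : realType) (G1 G2 : sgraph) (v0 : G1) : iso G1 G2 -> rho R G1 <= rho R G2.
Proof.
move=> /iso_sym[f fb fE].
have [_ [z [_ [v zv] zE]] _] := rho_spectral R v0.
have [g fK gK] := fb.
have nE u : nbr_sum (z \o f) u = rho R G1 * (z \o f) u.
  rewrite /= -zE /nbr_sum (reindex f) /=; last exact: onW_bij.
  by apply: eq_bigr => w _; rewrite fE.
apply: (@rho_ge_rayleigh _ _ (z \o f) (g v)); first by rewrite /= gK.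
rewrite /sqnorm /qform mulr_sumr le_eqVlt; apply/orP; left; apply/eqP.
by apply: eq_bigr => w _; rewrite nE; ring.
Qed.

Lemma rho_iso (R : realType) (G1 G2 : sgraph) (v0 : G1) : iso G1 G2 -> rho R G1 = rho R G2.
Proof.
move=> G12; apply/eqP; rewrite eq_le (rho_iso_le _ v0) //=.
by have [f _ _] := G12; apply: (rho_iso_le _ (f v0)); apply: iso_sym.
Qed.

End RhoIso.

(** * Degree counts and extension of partial bijections *)

(** Both sides count ordered adjacent pairs; each edge carries two of them. *)
Lemma handshake (G : sgraph) : \sum_(x : G) degree x = 2 * #|edges G|.
Proof.
pose P := [set p : G * G | adj p.1 p.2].
have -> : \sum_(x : G) degree x = #|P|.
  rewrite -sum1_card (eq_bigl (fun p => adj p.1 p.2)); last by move=> p; rewrite inE.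
  rewrite -(pair_big_dep xpredT (fun x y => adj x y) (fun _ _ => 1)) /=.
  by apply: eq_bigr => x _; rewrite sum1_card.
rewrite -sum1_card (partition_big (fun p => [set p.1; p.2]) [in edges G]) /=; last first.
  move=> [x y]; rewrite !inE /= => xy.
  by apply/existsP; exists x; apply/existsP; exists y; rewrite xy eqxx.
rewrite mulnC -sum_nat_const; apply: eq_bigr => e.
rewrite inE => /existsP[x /existsP[y /andP[xy /eqP ->]]].
have nxy : x != y by apply: contraL xy => /eqP->; rewrite adj_irr.
rewrite sum1_card (eq_card (B := [set (x, y); (y, x)])).
  by rewrite cards2 xpair_eqE (negPf nxy).
move=> [a b]; rewrite unfold_in /P !inE /= !xpair_eqE; apply/andP/idP => [[ab /eqP ee]|].
  have : a \in [set x; y] by rewrite -ee !inE eqxx.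
  have : b \in [set x; y] by rewrite -ee !inE eqxx orbT.
  have nab : a != b by apply: contraL ab => /eqP->; rewrite adj_irr.
  rewrite !inE => /orP[] /eqP bE /orP[] /eqP aE; move: nab; rewrite ?aE ?bE ?eqxx ?orbT //.
by case/orP => /andP[/eqP-> /eqP->]; rewrite ?xy 1?adj_sym ?xy ?eqxx // setUC eqxx.
Qed.

Lemma degree_compl (G : sgraph) (x : G) :
  degree x + degree (x : graph_compl G) = #|G|.-1.
Proof.
rewrite -(cardC1 x) -(cardID [pred y | adj x y] (predC1 x)); congr (_ + _).
  apply: eq_card => y; rewrite !inE; case: eqP => [->|_]; last by [].
  by rewrite adj_irr.
by apply: eq_card => y; rewrite !inE /= /compl_adj eq_sym andbC.
Qed.

Lemma card_edges_compl (G : sgraph) :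
  #|edges G| + #|edges (graph_compl G)| = 'C(#|G|, 2).
Proof.
have C2 : 2 * 'C(#|G|, 2) = #|G| * #|G|.-1.
  rewrite mul2n bin2 halfK oddM.
  by case: #|G| => [|m] //=; rewrite andNb subn0.
apply/eqP; rewrite -(eqn_pmul2l (isT : 0 < 2)) mulnDr -!handshake C2.
rewrite -big_split (eq_bigr _ (fun x _ => degree_compl x)) /=.
by rewrite sum_nat_const.
Qed.

Lemma sum_mem_nat (T : finType) (A : {pred T}) : \sum_x (x \in A) = #|A|.
Proof.
by rewrite -sum1_card [RHS]big_mkcond; apply: eq_bigr => x _; case: (_ \in _).
Qed.

(** The partial bijection [f1 a |-> f2 a] extends to the whole type: list each
    side with its image first, and match the lists position by position. *)
Lemma extend_injections (A T1 T2 : finType) (f1 : A -> T1) (f2 : A -> T2) :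
  injective f1 -> injective f2 -> #|T1| = #|T2| ->
  exists2 g : T1 -> T2, bijective g & forall a, g (f1 a) = f2 a.
Proof.
move=> i1 i2 c12.
pose s (T : finType) (f : A -> T) := codom f ++ [seq x <- enum T | x \notin codom f].
have su (T : finType) (f : A -> T) : injective f -> uniq (s T f).
  move=> fi; rewrite cat_uniq filter_uniq ?enum_uniq // andbT; apply/andP; split.
    exact/injectiveP.
  by apply/hasPn=> x; rewrite mem_filter => /andP[].
have sm (T : finType) (f : A -> T) x : x \in s T f.
  by rewrite mem_cat mem_filter mem_enum andbT orbN.
have ss (T : finType) (f : A -> T) : injective f -> size (s T f) = #|T|.
  by move=> fi; rewrite cardE; apply/eqP; rewrite -uniq_size_uniq ?enum_uniq ?su // => x;
    rewrite sm mem_enum.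
case: (pickP (xpredT : pred T2)) => [d _|T20]; last first.
  have no (x : T1) : T2.
    have H : 0 < #|T2| by rewrite -c12; apply/card_gt0P; exists x.
    exact: (enum_val (Ordinal H)).
  have no1 (x : T1) : False by have := T20 (no x).
  exists no => [|a]; last by case: (no1 (f1 a)).
  by apply: inj_card_bij; rewrite ?c12 // => x; case: (no1 x).
have lt x : index x (s _ f1) < size (s _ f2) by rewrite ss // -c12 -(ss _ f1) // index_mem sm.
exists (fun x => nth d (s _ f2) (index x (s _ f1))) => [|a].
  apply: inj_card_bij; last by rewrite c12.
  move=> x y /eqP; rewrite nth_uniq ?su // => /eqP e.
  by rewrite -(nth_index x (sm _ f1 x)) e nth_index.
rewrite index_cat codom_f nth_cat size_codom.
rewrite (_ : index _ _ = enum_rank a).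
  by rewrite ltn_ord /= nth_codom enum_rankK.
rewrite /codom /image_mem index_map // -[in LHS](enum_rankK a).
by rewrite /enum_val index_uniq ?enum_uniq // -cardE ltn_ord.
Qed.

(** * Degrees and neighbour sums in a member of the family *)

Section Member.
Variables (n k h : nat) (H : sgraph).
Notation W := 'I_(k - h - 1).
Notation Y := 'I_(n - k - h - 1).
Variable B : {set H * Y}.
Notation G := (L2_graph n k h B).

Definition missing_deg (x : H) : nat := degree (x : graph_compl H).
Definition cross_degX (x : H) : nat := \sum_(y : Y) ((x, y) \in B).
Definition cross_degY (y : Y) : nat := \sum_(x : H) ((x, y) \in B).

Lemma sum_cross_degX : \sum_x cross_degX x = #|B|.
Proof.
rewrite /cross_degX pair_bigA /= -sum1_card [RHS]big_mkcond /=.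
by apply: eq_bigr => -[x y] _ /=; case: (_ \in B).
Qed.

Lemma sum_cross_degY : \sum_y cross_degY y = #|B|.
Proof. by rewrite -sum_cross_degX exchange_big. Qed.

Lemma degree_X x : degree (X_vertex n k h B x) = (k - h - 1) + (degree x + cross_degX x).
Proof.
rewrite /degree -sum1_card big_mkcond /= big_sumType big_sumType /=.
congr (_ + (_ + _)).
- rewrite (eq_bigr (fun=> 1)) => [|i _].
    by rewrite big_const_ord iter_addn_0 mul1n.
  by [].
- rewrite -sum1_card [RHS]big_mkcond; apply: eq_bigr => y _.
  by rewrite !inE /L2_adj /= orbF.
Qed.

Local Open Scope ring_scope.
Variable R : realType.
Implicit Type z : G -> R.

Definition vW (i : W) : G := inl i.
Definition vX (x : H) : G := inr (inl x).
Definition vY (y : Y) : G := inr (inr y).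

Lemma sum_G (V : nmodType) (F : G -> V) :
  \sum_v F v = \sum_i F (vW i) + (\sum_x F (vX x) + \sum_y F (vY y)).
Proof. by rewrite big_sumType big_sumType. Qed.

Lemma sum_neq (T : finType) (F : T -> R) (i : T) :
  \sum_j (i != j)%:R * F j = \sum_j F j - F i.
Proof.
rewrite [in RHS](bigD1 i) //= [LHS](bigD1 i) //= eqxx mul0r add0r [F i + _]addrC addrK.
by apply: eq_bigr => j; rewrite eq_sym => ->; rewrite mul1r.
Qed.

Lemma nbr_sumW z i : nbr_sum z (vW i) =
  \sum_i z (vW i) - z (vW i) + (\sum_x z (vX x) + \sum_y z (vY y)).
Proof.
rewrite /nbr_sum sum_G -sum_neq; congr (_ + (_ + _)); apply: eq_bigr => u _.
- by rewrite /= /L2_adj /= orbF.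
- by rewrite /= /L2_adj /= mul1r.
by rewrite /= /L2_adj /= mul1r.
Qed.

Lemma nbr_sumX z x : nbr_sum z (vX x) =
  \sum_i z (vW i) + (\sum_u (adj x u)%:R * z (vX u) + \sum_y ((x, y) \in B)%:R * z (vY y)).
Proof.
rewrite /nbr_sum sum_G; congr (_ + (_ + _)); apply: eq_bigr => u _.
- by rewrite /= /L2_adj /= mul1r.
- by rewrite /= /L2_adj /= orbF.
Qed.

Lemma nbr_sumY z y : nbr_sum z (vY y) =
  \sum_i z (vW i) + (\sum_x ((x, y) \in B)%:R * z (vX x) + (\sum_y z (vY y) - z (vY y))).
Proof.
rewrite /nbr_sum sum_G -sum_neq; congr (_ + (_ + _)); apply: eq_bigr => u _.
- by rewrite /= /L2_adj /= mul1r.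
by rewrite /= /L2_adj /= orbF.
Qed.

Lemma sum_incidence (F : H -> R) :
  \sum_y \sum_x ((x, y) \in B)%:R * F x = \sum_x (cross_degX x)%:R * F x.
Proof.
rewrite exchange_big; apply: eq_bigr => x _ /=.
by rewrite /cross_degX natr_sum mulr_suml.
Qed.

(** Neighbour sums over [H] are controlled through the missing-edge graph, where a
    vertex has at most one neighbour in the case of a matching. *)
Lemma sum_compl_adj (F : H -> R) x :
  \sum_u (adj x u)%:R * F u =
  \sum_u F u - F x - \sum_u (@adj (graph_compl H) x u)%:R * F u.
Proof.
rewrite -sum_neq -sumrB; apply: eq_bigr => u _; rewrite /= /compl_adj.
have [->|_] := eqVneq x u; first by rewrite adj_irr !mul0r subr0.
by case: adj; rewrite ?mul0r ?subr0 ?subrr.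
Qed.

End Member.

(** A vertex [x] of [X] has degree [delta - missing_deg x + cross_degX x], so the
    degree condition reads [missing_deg x <= cross_degX x]. Both sides sum to
    [2 h] over [X], hence they agree at every vertex: the missing-edge graph
    prescribes how many exceptional edges leave each vertex. *)
Lemma L2_degrees n k delta (H : sgraph) (B : {set H * 'I_(n - k - (delta - k) - 1)}) :
  k <= delta <= 2 * k - 1 -> 0 < k -> L2_data n k delta B ->
  (forall x, cross_degX B x = missing_deg x) /\ \sum_x missing_deg (x : H) = 2 * (delta - k).
Proof.
set h := delta - k => /andP[kd dk] k0 [cH _ eH cB dB].
have hC : h <= 'C(2 * h + 2, 2).
  by rewrite bin2 -divn2; have := leq_div2r; nia.
have sM : \sum_x missing_deg (x : H) = 2 * h.
  have := card_edges_compl H; rewrite eH cH -/h.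
  move=> eC; apply: etrans (handshake (graph_compl H)) _; lia.
split=> //.
have le x : missing_deg x <= cross_degX B x.
  have := dB x; rewrite degree_X; have := degree_compl x; rewrite -/(missing_deg x) cH.
  lia.
move=> x; apply/eqP; rewrite eqn_leq le andbT.
have := sum_cross_degX B; rewrite cB -sM (bigD1 x) //= [in RHS](bigD1 x) //=.
have : \sum_(i | i != x) missing_deg i <= \sum_(i | i != x) cross_degX B i by apply: leq_sum.
by move=> le1 e; rewrite -(leq_add2r (\sum_(i | i != x) cross_degX B i)) e leq_add2l.
Qed.

(** * The spectral radius up to order [1 / N ^ 2] *)

Section Asymptotics.
Local Open Scope ring_scope.
Variables (R : realType) (n k h : nat) (H : sgraph).
Notation Y := 'I_(n - k - h - 1).
Variable B : {set H * Y}.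
Notation G := (L2_graph n k h B).
Variable y0 : Y.

Definition clique_size : R := ((k - h - 1) + (n - k - h - 1))%:R.
Definition clique_deg (x : H) : R := ((k - h - 1) + cross_degX B x)%:R.
Definition sq_clique_deg : R := \sum_x clique_deg x ^+ 2.
Local Notation N := clique_size.
Local Notation c := clique_deg.
Local Notation s := sq_clique_deg.

Lemma clique_size_gt0 : 0 < N.
Proof. by rewrite ltr0n addn_gt0 (leq_ltn_trans _ (ltn_ord y0)) ?orbT. Qed.

Lemma sum_clique_deg (F : H -> R) :
  (k - h - 1)%:R * \sum_x F x + \sum_y \sum_x ((x, y) \in B)%:R * F x =
  \sum_x c x * F x.
Proof.
rewrite sum_incidence mulr_sumr -big_split; apply: eq_bigr => x _ /=.
by rewrite /clique_deg natrD mulrDl.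
Qed.

Lemma clique_degE x :
  (k - h - 1)%:R + \sum_y ((x, y) \in B)%:R = c x.
Proof. by rewrite /c natrD natr_sum. Qed.

(** Test vector: the first-order approximation of the top eigenvector, [1] on
    the clique and [c x / N] on [X]. The edges inside [X] only help. *)
Lemma rho_lower_bound : s <= N ^+ 2 -> N - 1 + s / N ^+ 2 <= rho R G.
Proof.
move=> sN; have N0 := clique_size_gt0; have NN : N != 0 by lra.
pose z (v : G) : R := if v is inr (inl x) then c x / N else 1.
have z1 : z (vY B y0) != 0 by rewrite oner_eq0.
apply: (rho_ge_rayleigh z1).
have NE : N = (k - h - 1)%:R + (n - k - h - 1)%:R by rewrite -natrD.
have -> : sqnorm z = N + s / N ^+ 2.
  rewrite /sqnorm sum_G /= !sumr_const !card_ord expr1n [X in _ + X]addrC addrA.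
  rewrite -NE; congr (_ + _); rewrite /s mulr_suml.
  by apply: eq_bigr => x _; rewrite expr_div_n.
have -> : qform z = N * (N - 1) + 2 * (s / N) + \sum_x (c x / N) * \sum_u (adj x u)%:R * z (vX B u).
  rewrite /qform sum_G.
  under eq_bigr do rewrite nbr_sumW.
  under [X in _ + (X + _)]eq_bigr do rewrite nbr_sumX.
  under [X in _ + (_ + X)]eq_bigr do rewrite nbr_sumY.
  rewrite /= !sumr_const !card_ord -/(_%:R).
  have cc : \sum_x c x * (c x / N) = s / N.
    by rewrite /s mulr_suml; apply: eq_bigr => x _; rewrite expr2 mulrA.
  have E := sum_clique_deg (fun x => c x / N); rewrite cc in E.
  set Q := RHS; rewrite [X in _ + (X + _)](_ : _ = s / N +
      \sum_x c x / N * \sum_u (adj x u)%:R * (c u / N)); last first.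
    rewrite -cc -big_split; apply: eq_bigr => x _ /=.
    have <- := clique_degE x; under [X in _ * (_ + (_ + X))]eq_bigr do rewrite mulr1.
    by ring.
  rewrite [X in _ + (_ + X)](_ : _ = (n - k - h - 1)%:R * (N - 1) +
      \sum_y \sum_x ((x, y) \in B)%:R * (c x / N)); last first.
    rewrite NE -[in X in X * _](card_ord (n - k - h - 1)) mulr_natl -sumr_const -big_split.
    by apply: eq_bigr => y _ /=; ring.
  have -> : \sum_y \sum_x ((x, y) \in B)%:R * (c x / N) =
      s / N - (k - h - 1)%:R * (\sum_x c x / N) by rewrite -E; ring.
  have mE : (n - k - h - 1)%:R = N - (k - h - 1)%:R by rewrite NE; ring.
  by rewrite /Q -[_ *+ (k - h - 1)]mulr_natl mE; ring.
have q0 : 0 <= \sum_x (c x / N) * \sum_u (adj x u)%:R * z (vX B u).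
  apply: sumr_ge0 => x _; apply: mulr_ge0; first by rewrite divr_ge0 ?ler0n // ltW.
  by apply: sumr_ge0 => u _; rewrite mulr_ge0 ?ler0n // divr_ge0 ?ler0n // ltW.
have s0 : 0 <= s by apply: sumr_ge0 => x _; exact: sqr_ge0.
have -> : s / N = N * (s / N ^+ 2) by rewrite expr2 invfM mulrCA mulVKf // mulrC.
(* The form exceeds the claimed multiple of |z|^2 by at least r (1 - r), r = s / N^2. *)
have r0 : 0 <= s / N ^+ 2 * (1 - s / N ^+ 2).
  have NN2 : 0 < N ^+ 2 by rewrite exprn_gt0.
  apply: mulr_ge0; first by rewrite divr_ge0 // ltW.
  by rewrite subr_ge0 ler_pdivrMr // mul1r.
move: (s / N ^+ 2) r0 => r r0; move: q0; lra.
Qed.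

(** Supersolution: [c x / N + K / N ^ 2] on [X], and one plus [1 / N] times the
    sum over the neighbours in [X] on the clique. The constant [K] absorbs
    the second-order terms in the inequality at the vertices of [X]; the spare
    [1 / N ^ 2] in the bound absorbs what [K] costs at the clique vertices. *)
Lemma rho_upper_bound (P : R) : 1 <= P -> #|H|%:R <= P -> (forall x, c x <= P) ->
  P ^+ 2 * (P + 1 + 2 * P * (P + 1)) <= N ->
  rho R G <= N - 1 + (s + 1) / N ^+ 2.
Proof.
move=> P1 HP cP; set K := P + 1 + _ => KN.
have N0 := clique_size_gt0; have NN : N != 0 by lra.
pose t := N - 1 + (s + 1) / N ^+ 2.
have NE : N = (k - h - 1)%:R + (n - k - h - 1)%:R by rewrite -natrD.
have s0 : 0 <= s by apply: sumr_ge0 => x _; exact: sqr_ge0.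
have c0 x : 0 <= c x by rewrite ler0n.
have P2 : 1 <= P ^+ 2 by rewrite exprn_ege1.
have PK : P + 1 <= K by rewrite /K; nra.
have leKN : K <= N by nra.
pose ux x := c x / N + K / N ^+ 2.
pose U := \sum_x ux x.
pose d y := \sum_x ((x, y) \in B)%:R * ux x.
have ux0 x : 0 < ux x.
  by rewrite ltr_pwDr // ?divr_gt0 ?exprn_gt0 ?divr_ge0 ?c0 ?ltW //; lra.
have uxP x : ux x <= (P + 1) / N.
  rewrite [X in _ <= X]mulrDl; apply: lerD; first by rewrite ler_wpM2r ?invr_ge0 ?(ltW N0).
  by rewrite ler_pdivrMr ?exprn_gt0 // mul1r expr2 mulKf.
have U0 : 0 <= U by apply: sumr_ge0 => x _; exact: ltW.
have sumP (F : H -> R) a : 0 <= a -> (forall x, F x <= a) -> \sum_x F x <= P * a.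
  move=> a0 Fa; apply: le_trans (_ : \sum_(x : H) a <= _); first exact: ler_sum.
  by rewrite sumr_const -[_ *+ _]mulr_natl ler_wpM2r.
have PN0 : 0 <= (P + 1) / N by rewrite divr_ge0 ?(ltW N0) //; lra.
have UP : U <= P * ((P + 1) / N) by apply: sumP.
have d0 y : 0 <= d y by apply: sumr_ge0 => x _; rewrite mulr_ge0 ?ler0n ?ltW.
have dU y : d y <= U.
  by apply: ler_sum => x _; case: (_ \in _); rewrite ?mul1r ?mul0r // ltW.
pose z (v : G) : R := match v with
  | inl _ => 1 + U / N | inr (inl x) => ux x | inr (inr y) => 1 + d y / N end.
(* The X-part contributes s / N^2 + O(K P^2 / N^3), and K P^2 <= N. *)
have sumQ : \sum_i z (vW B i) + \sum_y z (vY B y) <= N + (s + 1) / N ^+ 2.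
  have -> : \sum_i z (vW B i) + \sum_y z (vY B y) = N + (\sum_x c x * ux x) / N.
    rewrite /= sumr_const card_ord big_split /= sumr_const card_ord -mulr_suml.
    rewrite -sum_clique_deg -/U -[\sum_y _]/(\sum_y d y) -[_ *+ (k - h - 1)]mulr_natl.
    have -> : (n - k - h - 1)%:R = N - (k - h - 1)%:R by rewrite NE; ring.
    by ring.
  rewrite lerD2l.
  have -> : \sum_x c x * ux x = s / N + (\sum_x c x) * (K / N ^+ 2).
    rewrite /s !mulr_suml -big_split; apply: eq_bigr => x _ /=; rewrite /ux; ring.
  have sc : \sum_x c x <= P * P by apply: sumP => //; lra.
  have -> : (s / N + (\sum_x c x) * (K / N ^+ 2)) / N =
     s / N ^+ 2 + (\sum_x c x) * K / N / N ^+ 2 by rewrite expr2 invfM; ring.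
  rewrite mulrDl lerD2l ler_wpM2r ?invr_ge0 ?exprn_ge0 ?(ltW N0) //.
  rewrite ler_pdivrMr // mul1r; apply: le_trans KN.
  by rewrite expr2 ler_wpM2r //; lra.
have tE : t + 1 = N + (s + 1) / N ^+ 2 by rewrite /t; ring.
have e0 : 0 <= (s + 1) / N ^+ 2 by rewrite divr_ge0 ?exprn_ge0 ?(ltW N0) //; lra.
(* a is the sum of the entries at the X-neighbours of a clique vertex. *)
have cliqueP a : 0 <= a -> N + (s + 1) / N ^+ 2 + a <= (t + 1) * (1 + a / N).
  move=> a0; rewrite tE.
  rewrite mulrDr mulr1 lerD2l mulrDl mulrCA divff // mulr1 lerDl.
  by rewrite mulr_ge0 // divr_ge0 // ltW.
apply: (@rho_le_supersolution _ _ (vY B y0) z).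
  case=> [i|[x|y]] //=; rewrite ltr_pwDl // divr_ge0 ?(ltW N0) //.
case=> [i|[x|y]]; rewrite -/t.
- rewrite (nbr_sumW z i) /= -/U; have := cliqueP _ U0; rewrite [X in _ <= X]mulrDl mul1r.
  move: sumQ => /=; lra.
- rewrite (nbr_sumX z x) /=.
  have PN : P <= N by lra.
  have lhs : \sum_(i < k - h - 1) (1 + U / N) + (\sum_u (adj x u)%:R * ux u +
      \sum_y ((x, y) \in B)%:R * (1 + d y / N)) <= c x * (1 + U / N) + U.
    have crossle : \sum_y ((x, y) \in B)%:R * (1 + d y / N) <=
        (\sum_y ((x, y) \in B)%:R) * (1 + U / N).
      rewrite mulr_suml; apply: ler_sum => y _.
      by rewrite ler_wpM2l // lerD2l ler_wpM2r ?invr_ge0 ?(ltW N0).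
    have Hle : \sum_u (adj x u)%:R * ux u <= U.
      by apply: ler_sum => u _; case: adj; rewrite ?mul1r ?mul0r // ltW.
    rewrite -clique_degE sumr_const card_ord -[_ *+ (k - h - 1)]mulr_natl [X in _ <= X + _]mulrDl.
    lra.
  apply: le_trans lhs _.
  have cU : c x * (U / N) <= U.
    by rewrite mulrA ler_pdivrMr // mulrC ler_wpM2l //; apply: le_trans (cP x) PN.
  have rhs : (N - 1) * ux x <= t * ux x by rewrite ler_wpM2r ?(ltW (ux0 x)) // lerDl.
  apply: le_trans rhs.
  have NuE : N * ux x = c x + K / N.
    by rewrite mulrDr mulrCA divff // mulr1 expr2 invfM [K * _]mulrA mulrCA divff // mulr1.
  have KE : K / N = (P + 1) / N + 2 * (P * ((P + 1) / N)) by rewrite /K; ring.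
  have := uxP x; rewrite mulrBl mul1r NuE KE mulrDr mulr1.
  lra.
rewrite (nbr_sumY z y) /= -/(d y); have := cliqueP _ (d0 y); rewrite [X in _ <= X]mulrDl mul1r.
move: sumQ => /=; lra.
Qed.
End Asymptotics.

(** * Matchings of missing edges and the candidate minimizer *)

Local Notation pairs h := ('I_h * 'I_2)%type.

(** [g (i, 0)] and [g (i, 1)] are the ends of the [i]-th missing edge, and the
    missing edges form a matching. *)
Definition matching_labels (h : nat) (H : sgraph) (g : pairs h -> H) :=
  [/\ injective g,
      forall u v, @adj (graph_compl H) (g u) (g v) = (u.1 == v.1) && (u.2 != v.2)
    & forall x, missing_deg x = (x \in codom g)].

Lemma edgeP (G : sgraph) (e : {set G}) : e \in edges G ->
  exists x y : G, [/\ adj x y, x != y & e = [set x; y]].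
Proof.
rewrite inE => /existsP[x /existsP[y /andP[xy /eqP ->]]]; exists x, y; split=> //.
by apply: contraL xy => /eqP->; rewrite adj_irr.
Qed.

Lemma adj_mem_edge (G : sgraph) (e : {set G}) x y :
  e \in edges G -> x \in e -> y \in e -> x != y -> adj x y.
Proof.
move=> /edgeP[a [b [ab _ ->]]]; rewrite !inE.
by case/orP=> /eqP-> /orP[] /eqP->; rewrite ?eqxx // adj_sym.
Qed.

(** Degrees at most one make the [h] missing edges pairwise disjoint, so they can
    be numbered and the two ends of each can be listed. *)
Lemma matching_labelling (h : nat) (H : sgraph) : #|H| = 2 * h + 2 ->
  \sum_x missing_deg (x : H) = 2 * h -> (forall x : H, missing_deg x <= 1) ->
  exists g : pairs h -> H, matching_labels g.
Proof.
move=> cH sM M1; set M := graph_compl H.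
have cE : #|edges M| = h by have := handshake M; rewrite [LHS]sM; lia.
have [x0 _] : exists x : H, x \in H by apply/card_gt0P; rewrite cH; lia.
pose e (i : 'I_h) : {set M} := enum_val (cast_ord (esym cE) i).
have eE i : e i \in edges M by apply: enum_valP.
have e_inj : injective e by move=> i j /enum_val_inj /cast_ord_inj.
have e2 i : #|e i| = 2.
  by have [x [y [_ xy ->]]] := edgeP (eE i); rewrite cards2 xy.
have uniqM (x y z : M) : adj x y -> adj x z -> y = z.
  move=> xy xz; apply/eqP; apply: contraT => yz.
  have := M1 x; rewrite leqNgt; case/negP.
  apply: leq_trans (_ : #|[set y; z]| <= _); first by rewrite cards2 yz.
  by apply: subset_leq_card; apply/subsetP => u; rewrite !inE => /orP[] /eqP->.
have e_disj i j x : x \in e i -> x \in e j -> i = j.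
  move=> xi xj; apply: e_inj.
  have other l : x \in e l -> exists2 y, adj x y & e l = [set x; y].
    have [a [b [ab _ ->]]] := edgeP (eE l); rewrite !inE => /orP[] /eqP->; first by exists b.
    by exists a; [rewrite adj_sym | rewrite setUC].
  have [a xa ->] := other _ xi; have [b xb ->] := other _ xj.
  by rewrite (uniqM _ _ _ xa xb).
pose g (u : pairs h) : H := nth x0 (enum (e u.1)) u.2.
have ge u : g u \in e u.1 by rewrite -mem_enum mem_nth // -cardE e2.
have g_inj : injective g.
  move=> [i j] [i' j'] gg; have ii : i = i'.
    by apply: (e_disj _ _ (g (i, j))); rewrite ?ge // gg ge.
  subst i'; congr (_, _); apply/val_inj/eqP.
  have lt (l : 'I_2) : l < size (enum (e i)) by rewrite -cardE e2.
  rewrite -(nth_uniq x0 (lt j) (lt j') (enum_uniq (e i))); exact/eqP.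
exists g; split=> //.
  move=> u v; apply/idP/andP => [uv|[/eqP uv1 uv2]].
    suff uv1 : u.1 = v.1.
      split; first exact/eqP.
      apply: contraL uv => /eqP uv2; rewrite (_ : u = v) ?(@adj_irr M) //.
      by rewrite [u]surjective_pairing uv1 uv2 -surjective_pairing.
    have /edgeP[a [b [ab _ eE']]] := eE u.1.
    apply: (e_disj _ _ (g v)); last exact: ge.
    have : g u \in e u.1 := ge u; rewrite eE' !inE => /orP[] /eqP gu.
      by rewrite (uniqM _ _ _ ab (_ : adj a (g v : M))) ?eqxx ?orbT // -gu.
    rewrite adj_sym in ab.
    by rewrite (uniqM _ _ _ ab (_ : adj b (g v : M))) ?eqxx ?orbT // -gu.
  apply: (adj_mem_edge (eE u.1)) => //; first by rewrite uv1.
  by rewrite (inj_eq g_inj); apply: contra uv2 => /eqP->.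
have le x : (x \in codom g) <= missing_deg x.
  case: (boolP (x \in codom g)) => // /codomP[u ->].
  have [a [b [ab _ eab]]] := edgeP (eE u.1).
  have := ge u; rewrite eab !inE => /orP[] /eqP->; apply/card_gt0P.
    by exists b.
  by exists a; rewrite inE adj_sym.
have sg : \sum_x (x \in codom g) = 2 * h.
  by rewrite sum_mem_nat card_codom // card_prod !card_ord mulnC.
move=> x; apply/eqP; rewrite eqn_leq le andbT.
have : \sum_(i | i != x) (i \in codom g) <= \sum_(i | i != x) missing_deg i by apply: leq_sum.
have := sM; rewrite -sg (bigD1 x) //= [in RHS](bigD1 x) //= => e1 e2'.
by rewrite -(leq_add2r (\sum_(i | i != x) missing_deg i)) e1 leq_add2l.
Qed.

Section MinGraph.
Variables (n k h : nat).
Notation Y := 'I_(n - k - h - 1).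

Definition min_X := graph_compl (hK2_2K1 h).

(** The end [v] of a missing edge receives the single exceptional edge to
    [f v]; for injective [f] the ends in [Y] are distinct. *)
Definition min_cross (f : pairs h -> Y) : {set min_X * Y} :=
  [set p | if p.1 is inl v then p.2 == f v else false].

Definition min_graph f := L2_graph n k h (min_cross f).

Lemma adj_compl_compl (G : sgraph) (x y : G) :
  @adj (graph_compl (graph_compl G)) x y = adj x y.
Proof.
rewrite /= /compl_adj /= /compl_adj; have [->|_] /= := eqVneq x y; last by rewrite negbK.
by rewrite adj_irr.
Qed.

Lemma min_X_inl (u v : pairs h) :
  @adj (graph_compl min_X) (inl u) (inl v) = (u.1 == v.1) && (u.2 != v.2).
Proof. exact: adj_compl_compl. Qed.

Lemma min_X_inr (u : 'I_2 * 'I_1) (v : min_X) :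
  @adj (graph_compl min_X) (inr u) v = false.
Proof.
rewrite adj_compl_compl; case: v => // -[i j]; case: u => i' j' /=.
by rewrite /copies_adj /= /complete_adj !ord1 eqxx andbF.
Qed.

Lemma min_X_iso (H : sgraph) (g : pairs h -> H) : #|H| = 2 * h + 2 ->
  matching_labels g ->
  exists phi : min_X -> H, [/\ bijective phi,
    forall u, phi (inl u) = g u & forall x y, adj (phi x) (phi y) = adj x y].
Proof.
move=> cH [g_inj gE gM].
have inl_inj : injective (inl : pairs h -> min_X) by move=> ? ? [].
have cc : #|min_X| = #|H|.
  by rewrite cH card_sum !card_prod !card_ord mulnC.
have [phi phib phig] := extend_injections inl_inj g_inj cc.
have phi_inj := bij_inj phib.
exists phi; split=> // x y.
have E : @adj (graph_compl H) (phi x) (phi y) = @adj (graph_compl min_X) x y.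
  have nM (u : 'I_2 * 'I_1) z : @adj (graph_compl H) (phi (inr u)) z = false.
    apply/negP => uz; have : phi (inr u) \notin codom g.
      by apply/negP => /codomP[v]; rewrite -phig => /phi_inj.
    have := gM (phi (inr u)) => mu; rewrite -[_ \in _]lt0b -mu => /negP; apply.
    by apply/card_gt0P; exists z.
  case: x y => [x|x] [y|y]; rewrite ?nM ?min_X_inr //.
    by rewrite !phig gE min_X_inl.
  by rewrite adj_sym nM adj_sym min_X_inr.
have complE (G : sgraph) (a b : G) : adj a b = (a != b) && ~~ @adj (graph_compl G) a b.
  by rewrite -adj_compl_compl.
by rewrite [LHS]complE E (inj_eq phi_inj) -complE.
Qed.

End MinGraph.

Section MinData.
Variables (n k h : nat).
Notation Y := 'I_(n - k - h - 1).
Variable f : pairs h -> Y.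

Lemma card_min_X : #|min_X h| = 2 * h + 2.
Proof. by rewrite card_sum !card_prod !card_ord mulnC. Qed.

Lemma min_X_labels : matching_labels (inl : pairs h -> min_X h).
Proof.
split; first by move=> ? ? [].
  exact: min_X_inl.
case=> [[i j]|u]; rewrite /missing_deg /degree.
  rewrite codom_f (eq_card (B := pred1 (inl (i, rev_ord j) : graph_compl (min_X h)))) ?card1 //.
  case=> [[i' j']|v]; last by rewrite !inE adj_sym min_X_inr.
  rewrite !inE min_X_inl /= (inj_eq (@inl_inj _ _)) xpair_eqE eq_sym; congr (_ && _).
  by case: j j' => [[|[|?]] ?] [[|[|?]] ?].
rewrite (_ : _ \in _ = false); last by apply/negP => /codomP[].
by apply: eq_card0 => v; rewrite inE min_X_inr.
Qed.

Lemma sum_missing_deg_min_X : \sum_x missing_deg (x : min_X h) = 2 * h.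
Proof.
have [g_inj _ gM] := min_X_labels.
rewrite (eq_bigr _ (fun x _ => gM x)) /=.
by rewrite sum_mem_nat card_codom // card_prod !card_ord mulnC.
Qed.

Lemma cross_degX_min_cross x : cross_degX (min_cross f) x = missing_deg x.
Proof.
have [_ _ ->] := min_X_labels; rewrite /cross_degX.
case: x => [u|u]; last first.
  rewrite (_ : _ \in _ = false); last by apply/negP => /codomP[].
  by rewrite big1 // => y _; rewrite inE.
rewrite codom_f (bigD1 (f u)) //= inE /= eqxx big1 // => y yf.
by rewrite inE /= (negPf yf).
Qed.

Lemma connected_min_X : graph_connected (min_X h).
Proof.
(* A vertex of X without missing edges is adjacent to all others. *)
pose c : min_X h := inr (ord0, ord0).
have cx (x : min_X h) : connect (@adj (min_X h)) c x.
  have [<-|ncx] := eqVneq c x; first exact: connect0.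
  apply: connect1; rewrite /= /compl_adj ncx /=.
  have := min_X_inr (ord0, ord0) x; rewrite adj_compl_compl => /negbT.
  by rewrite -/c.
move=> x y; apply: connect_trans (cx y).
by rewrite (sym_connect_sym (@adj_sym (min_X h))).
Qed.

Lemma min_graph_degrees delta (fd : delta - k = h) :
  k <= delta <= 2 * k - 1 -> 0 < k ->
  forall x : min_X h, delta <= degree (X_vertex n k h (min_cross f) x).
Proof.
move=> /andP[kd dk] k0 x; rewrite degree_X cross_degX_min_cross.
by have := degree_compl x; rewrite -/(missing_deg x) card_min_X; lia.
Qed.

Lemma card_min_cross : #|min_cross f| = 2 * h.
Proof.
rewrite -sum_cross_degX (eq_bigr _ (fun x _ => cross_degX_min_cross x)).
exact: sum_missing_deg_min_X.
Qed.

Lemma card_edges_min_X : #|edges (min_X h)| = 'C(2 * h + 2, 2) - h.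
Proof.
have := card_edges_compl (min_X h); rewrite card_min_X => <-.
by have := handshake (graph_compl (min_X h)); rewrite [LHS]sum_missing_deg_min_X; lia.
Qed.

(** A matching of missing edges, together with one private [Y]-end for each
    matched vertex, determines the graph: a bijection of the labels extends to
    [X], and the resulting bijection of the [Y]-ends extends to [Y]. *)
Lemma min_graph_iso (H : sgraph) (B : {set H * Y}) (g : pairs h -> H) :
  injective f -> #|H| = 2 * h + 2 -> matching_labels g ->
  (forall x, cross_degX B x = missing_deg x) ->
  {in B &, forall p q, p.2 = q.2 -> p = q} ->
  iso (L2_graph n k h B) (min_graph f) /\ iso (graph_compl H) (hK2_2K1 h).
Proof.
move=> f_inj cH gl bM B_inj.
have [phi [phib phig phiE]] := min_X_iso cH gl.
have phi_inj := bij_inj phib.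
have [g_inj gE gM] := gl.
split; last first.
  apply: iso_sym; exists phi => // x y.
  rewrite -[RHS]adj_compl_compl -[RHS]/((x != y) && ~~ @adj (min_X h) x y).
  by rewrite -phiE -(inj_eq phi_inj).
have ex1 u : exists y, (g u, y) \in B.
  apply/existsP; apply: contraT; rewrite negb_exists => /forallP no.
  have := bM (g u); rewrite gM codom_f /cross_degX big1 // => y _.
  by rewrite (negPf (no y)).
pose F u := xchoose (ex1 u).
have FB u : (g u, F u) \in B := xchooseP (ex1 u).
have FE u y : ((g u, y) \in B) = (y == F u).
  apply/idP/eqP => [uy|->]; last exact: FB.
  apply/eqP; apply: contraT => yF.
  have := bM (g u); rewrite gM codom_f /cross_degX (bigD1 (F u)) //= FB (bigD1 y) //= uy.
  by [].
have F_inj : injective F.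
  by move=> u v uv; have [/g_inj] := B_inj _ _ (FB u) (FB v) uv.
have [psi psib psiF] := extend_injections f_inj F_inj erefl.
have psi_inj := bij_inj psib.
have BE x y : ((phi x, psi y) \in B) = ((x, y) \in min_cross f).
  rewrite inE /=; case: x => [u|u].
    by rewrite phig FE -psiF (inj_eq psi_inj).
  apply/negP => uy; have := bM (phi (inr u)).
  rewrite gM (_ : _ \in _ = false); last first.
    by apply/negP => /codomP[v]; rewrite -phig => /phi_inj.
  by rewrite /cross_degX (bigD1 (psi y)) //= uy.
apply: iso_sym.
exists (fun v : min_graph f => match v return L2_graph n k h B with
  | inl i => inl i | inr (inl x) => inr (inl (phi x)) | inr (inr y) => inr (inr (psi y)) end).
  have [phi' phiK phi'K] := phib; have [psi' psiK psi'K] := psib.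
  exists (fun v : L2_graph n k h B => match v return min_graph f with
  | inl i => inl i | inr (inl x) => inr (inl (phi' x)) | inr (inr y) => inr (inr (psi' y)) end).
    by case=> [i|[x|y]]; rewrite ?phiK ?psiK.
  by case=> [i|[x|y]]; rewrite ?phi'K ?psi'K.
case=> [i|[x|y]] [i'|[x'|y']] //=; rewrite /L2_adj /= ?BE //.
  by rewrite phiE.
by rewrite /complete_adj (inj_eq psi_inj).
Qed.
End MinData.

(** * A shared [Y]-end increases the spectral radius *)

Section Strict.
Local Open Scope ring_scope.
Variables (R : realType) (n k h : nat).
Notation Y := 'I_(n - k - h - 1).

(** The eigenvalue equations of the candidate minimizer for a vector that takes
    the values [al] on [W], [a] and [b] on the matched and unmatched vertices
    of [X], and [y1] and [y0] on the used and unused vertices of [Y]. *)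
Definition quotient_eigen (w m h : nat) (r al a b y1 y0 : R) :=
  let SW := w%:R * al in let SX := (2 * h)%:R * a + 2 * b in
  let SY := (2 * h)%:R * y1 + (m%:R - (2 * h)%:R) * y0 in
  [/\ (r + 1) * al = SW + SX + SY, (r + 2) * a = SW + SX + y1,
      (r + 1) * b = SW + SX, (r + 1) * y1 = SW + SY + a & (r + 1) * y0 = SW + SY].

Lemma sum_indicator (T : finType) (A : {pred T}) (a b : R) :
  \sum_x (if x \in A then a else b) = #|A|%:R * a + (#|T|%:R - #|A|%:R) * b.
Proof.
rewrite (bigID (mem A)) /=.
rewrite (eq_bigr (fun=> a)) => [|x ->] //.
rewrite [X in _ + X](eq_bigr (fun=> b)) => [|x /negPf->] //.
rewrite !sumr_const -[a *+ _]mulr_natl -[b *+ _]mulr_natl; congr (_ * _ + _ * _).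
rewrite -(cardC A) natrD addrC addKr; congr (_%:R).
Qed.

Lemma superset_of_card (T : finType) (A : {set T}) (c : nat) : (#|A| <= c <= #|T|)%N ->
  exists2 D : {set T}, #|D| = c & A \subset D.
Proof.
move=> /andP[Ac cT]; pose s := enum A ++ enum (~: A).
have us : uniq s.
  rewrite cat_uniq !enum_uniq andbT /=; apply/hasPn => x.
  by rewrite !mem_enum inE.
have ss : size s = #|T| by rewrite size_cat -!cardE cardsC.
exists [set x in take c s].
  by rewrite cardsE; have /card_uniqP -> := take_uniq c us; rewrite size_takel ?ss.
apply/subsetP=> x xA; rewrite inE take_cat -cardE.
rewrite ltnNge Ac /=.
by rewrite mem_cat mem_enum xA.
Qed.

Lemma sum_mate (u : pairs h) (F : min_X h -> R) :
  \sum_w (@adj (graph_compl (min_X h)) (inl u) w)%:R * F w = F (inl (u.1, rev_ord u.2)).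
Proof.
rewrite (bigD1 (inl (u.1, rev_ord u.2))) //.
rewrite min_X_inl eqxx /= (_ : _ != _); last by case: u => i [[|[|?]] ?].
rewrite mul1r big1 ?addr0 // => w wn.
rewrite -[X in X%:R * _]/(nat_of_bool (@adj (graph_compl (min_X h)) (inl u) w)).
case: w wn => [v|v] wn; last by rewrite adj_sym min_X_inr mul0r.
rewrite min_X_inl; case: eqP => [uv1|]; last by rewrite mul0r.
case: (boolP (_ != _)) => [uv2|]; last by rewrite mul0r.
case/negP: wn; apply/eqP; congr inl; rewrite [v]surjective_pairing uv1; congr (_, _).
by move: uv2; case: (u.2) (v.2) => [[|[|?]] ?] [[|[|?]] ?] // _; apply: val_inj.
Qed.

Lemma eq0_of_loop (c r d e : R) : 1 <= c -> 1 <= r -> c * d = e -> (r + 1) * e = d -> d = 0.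
Proof.
move=> c1 r1 <- dE; have /eqP : ((r + 1) * c - 1) * d = 0 by rewrite mulrBl mul1r -mulrA dE subrr.
rewrite mulf_eq0 => /orP[/eqP|/eqP //]; nra.
Qed.

(** A nonnegative top eigenvector is constant on each class. Subtracting the
    equations at two matched vertices and at their [Y]-ends gives a homogeneous
    system [eq0_of_loop] whose only solution is zero because [rho >= 1]. If the
    value [a] vanished, the equations would propagate zero to every vertex. *)
Lemma min_graph_quotient (f : pairs h -> Y) (v0 : Y) : injective f -> (0 < h)%N ->
  1 <= rho R (min_graph f) ->
  exists al a b y1 y0 : R,
    quotient_eigen (k - h - 1) (n - k - h - 1) h (rho R (min_graph f)) al a b y1 y0 /\ 0 < a.
Proof.
move=> f_inj h0 r1.
have [_ [z [z0 [v zv] zE]] _] := rho_spectral R (vY (min_cross f) v0 : min_graph f).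
move: (rho R (min_graph f)) r1 zE => r r1 zE.
pose SW := \sum_i z (vW (min_cross f) i).
pose SX := \sum_x z (vX (min_cross f) x).
pose SY := \sum_y z (vY (min_cross f) y).
pose zx u := z (vX (min_cross f) (inl u)).
pose zy u := z (vY (min_cross f) (f u)).
have eW i : (r + 1) * z (vW (min_cross f) i) = SW + SX + SY.
  have := zE (vW (min_cross f) i); rewrite nbr_sumW -/SW -/SX -/SY; lra.
have eX u : (r + 1) * zx u + zx (u.1, rev_ord u.2) = SW + SX + zy u.
  have := zE (vX (min_cross f) (inl u)).
  rewrite nbr_sumX sum_compl_adj sum_mate -/SW -/SX -/(zx u) -/(zx (_, _)).
  rewrite (bigD1 (f u)) //= inE /= eqxx mul1r big1 => [|y /negPf yf]; last first.
    by rewrite inE /= yf mul0r.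
  rewrite -/(zy u); lra.
have eX' u : (r + 1) * z (vX (min_cross f) (inr u)) = SW + SX.
  have := zE (vX (min_cross f) (inr u)).
  rewrite nbr_sumX sum_compl_adj -/SW -/SX.
  rewrite [X in _ - X]big1 => [|w _]; last by rewrite min_X_inr mul0r.
  rewrite [X in _ + (_ + X)]big1 => [|y _]; last by rewrite inE mul0r.
  lra.
have eY u : (r + 1) * zy u = SW + SY + zx u.
  have := zE (vY (min_cross f) (f u)); rewrite nbr_sumY -/SW -/SY -/(zy u).
  rewrite (bigD1 (inl u)) //= inE /= eqxx mul1r big1 => [|[w|w] nw].
  - rewrite -/(zx u); lra.
  - rewrite inE /= (inj_eq f_inj) (_ : (u == w) = false) ?mul0r //.
    by apply: contraNF nw => /eqP->.
  by rewrite inE mul0r.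
have eY' y : y \notin codom f -> (r + 1) * z (vY (min_cross f) y) = SW + SY.
  move=> yf; have := zE (vY (min_cross f) y); rewrite nbr_sumY -/SW -/SY.
  rewrite big1 => [|[w|w] _]; rewrite ?inE /=; first lra.
    by case: eqP yf => [->|_ _]; rewrite ?codom_f // mul0r.
  by rewrite mul0r.
(* The two ends of one missing edge agree, then all matched vertices do. *)
have pairE u : zx u = zx (u.1, rev_ord u.2).
  have := eX u; have := eX (u.1, rev_ord u.2); rewrite /= rev_ordK -surjective_pairing.
  have := eY u; have := eY (u.1, rev_ord u.2) => e1 e2 e3 e4.
  apply/eqP; rewrite -subr_eq0; apply/eqP.
  apply: (@eq0_of_loop r r _ (zy u - zy (u.1, rev_ord u.2))) => //; lra.
have constE u v' : zx u = zx v'.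
  have := eX u; have := eX v'; rewrite -!pairE.
  have := eY u; have := eY v' => e1 e2 e3 e4.
  apply/eqP; rewrite -subr_eq0; apply/eqP.
  apply: (@eq0_of_loop (r + 2) r _ (zy u - zy v')) => //; lra.
pose u0 : pairs h := (Ordinal h0, ord0).
pose a := zx u0.
have rp : r + 1 != 0 by lra.
exists ((SW + SX + SY) / (r + 1)), a, ((SW + SX) / (r + 1)), (zy u0), ((SW + SY) / (r + 1)).
have hSW : (k - h - 1)%:R * ((SW + SX + SY) / (r + 1)) = SW.
  rewrite /SW mulr_natl -[X in _ *+ X]card_ord -sumr_const.
  by apply: eq_bigr => i _; rewrite -(eW i) mulrAC divff ?mul1r.
have hSX : (2 * h)%:R * a + 2 * ((SW + SX) / (r + 1)) = SX.
  rewrite {2}/SX big_sumType; congr (_ + _).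
    rewrite (eq_bigr (fun=> a)) => [|u _]; last exact: constE.
    by rewrite sumr_const card_prod !card_ord mulnC mulr_natl.
  rewrite (eq_bigr (fun=> (SW + SX) / (r + 1))) => [|u _]; last first.
    by rewrite -(eX' u) mulrAC divff ?mul1r.
  by rewrite sumr_const card_prod !card_ord muln1 mulr_natl.
have hSY : (2 * h)%:R * zy u0 + ((n - k - h - 1)%:R - (2 * h)%:R) * ((SW + SY) / (r + 1)) = SY.
  have cf : #|codom f| = (2 * h)%N by rewrite card_codom // card_prod !card_ord mulnC.
  rewrite -cf -[in X in X - _](card_ord (n - k - h - 1)) -sum_indicator.
  apply: eq_bigr => y _; case: (boolP (y \in codom f)) => [/codomP[u ->]|/eY' <-].
    by apply: (mulfI rp); rewrite -/(zy u) !eY (constE u u0).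
  by rewrite mulrAC divff ?mul1r.
have Ea : (r + 2) * a = SW + SX + zy u0.
  have := eX u0; rewrite -pairE -/a; lra.
split.
  by rewrite /quotient_eigen hSW hSX hSY; split=> //; rewrite mulrC divfK.
have SW0 : 0 <= SW by apply: sumr_ge0.
have SX0 : 0 <= SX by apply: sumr_ge0.
have SY0 : 0 <= SY by apply: sumr_ge0.
have y00 : 0 <= zy u0 by apply: z0.
rewrite lt_neqAle [0 <= a]z0 andbT eq_sym; apply: contra zv => /eqP a_eq0.
rewrite a_eq0 mulr0 in Ea.
have SW_0 : SW = 0 by lra.
have SX_0 : SX = 0 by lra.
have SY_0 : SY = 0.
  have := eY u0; rewrite -/a a_eq0 (_ : zy u0 = 0) ?mulr0; lra.
apply/eqP; apply: (mulfI rp); rewrite mulr0; case: v => [i|[[u|u]|y]].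
- by rewrite (eW i) SW_0 SX_0 SY_0 !addr0.
- by rewrite -[z _]/(zx u) (constE u u0) -/a a_eq0 mulr0.
- by rewrite (eX' u) SW_0 SX_0 addr0.
case: (boolP (y \in codom f)) => [/codomP[u ->]|/eY' ->]; last by rewrite SW_0 SY_0 addr0.
by rewrite -[z _]/(zy u) eY (constE u u0) -/a a_eq0 SW_0 SY_0 !addr0.
Qed.

(** Transplant the five values to the colliding graph, placing [y1] on a set
    [T] of [2 h] vertices that contains all the [Y]-ends in use. Only the
    equations in [T] change, by [(cross_degY y - 1) a], and these defects sum to
    zero: the Rayleigh quotient is still [r]. If [r] were at least the spectral
    radius, the vector would be an eigenvector, whereas the defect at the shared
    end [ys] is positive. *)
Lemma strict_of_collision (H : sgraph) (B : {set H * Y})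
    (g : pairs h -> H) (r al a b y1 y0 : R) (ys : Y) :
  #|H| = (2 * h + 2)%N -> (2 * h <= n - k - h - 1)%N ->
  matching_labels g -> (forall x, cross_degX B x = missing_deg x) -> #|B| = (2 * h)%N ->
  quotient_eigen (k - h - 1) (n - k - h - 1) h r al a b y1 y0 -> 0 < a ->
  (1 < cross_degY B ys)%N -> r < rho R (L2_graph n k h B).
Proof.
move=> cH hm [g_inj gE gM] bM cB [eW eX eX' eY eY'] a0 coll.
rewrite ltNge; apply/negP => rho_le.
have [T cT hitT] : exists2 T : {set Y}, #|T| = (2 * h)%N
    & [set y | (0 < cross_degY B y)%N] \subset T.
  apply: superset_of_card; rewrite card_ord hm andbT -cB -sum_cross_degY.
  rewrite -sum1_card big_mkcond; apply: leq_sum => y _; rewrite inE.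
  by case: ltngtP.
pose z (v : L2_graph n k h B) : R := match v with
  | inl _ => al
  | inr (inl x) => if x \in codom g then a else b
  | inr (inr y) => if y \in T then y1 else y0 end.
have cg : #|codom g| = (2 * h)%N by rewrite card_codom // card_prod !card_ord mulnC.
have sW : \sum_i z (vW B i) = (k - h - 1)%:R * al.
  by rewrite /= sumr_const card_ord -[LHS]mulr_natl.
have sX : \sum_x z (vX B x) = (2 * h)%:R * a + 2 * b.
  by rewrite /= sum_indicator cg cH natrD; ring.
have sY : \sum_y z (vY B y) = (2 * h)%:R * y1 + ((n - k - h - 1)%:R - (2 * h)%:R) * y0.
  by rewrite /= sum_indicator cT card_ord.
have BX x y : (x, y) \in B -> x \in codom g.
  move=> xy; rewrite -[_ \in _]lt0b -gM -bM /cross_degX (bigD1 y) //= xy; done.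
have BY x y : (x, y) \in B -> y \in T.
  move=> xy; apply: (subsetP hitT); rewrite inE /cross_degY (bigD1 x) //= xy; done.
have eW' i : nbr_sum z (vW B i) = r * z (vW B i).
  by rewrite nbr_sumW sW sX sY [z _]/=; lra.
have eXX x : nbr_sum z (vX B x) = r * z (vX B x).
  rewrite nbr_sumX sum_compl_adj sW sX.
  have -> : \sum_u (@adj (graph_compl H) x u)%:R * z (vX B u) = (missing_deg x)%:R * a.
    rewrite /missing_deg /degree -sum1_card natr_sum mulr_suml [RHS]big_mkcond.
    apply: eq_bigr => u _.
    rewrite inE; case: (boolP (@adj (graph_compl H) x u)) => xu; last by rewrite mul0r.
    rewrite !mul1r /= (_ : u \in codom g) // -[_ \in _]lt0b -gM.
    by apply/card_gt0P; exists x; rewrite inE adj_sym.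
  have -> : \sum_y ((x, y) \in B)%:R * z (vY B y) = (missing_deg x)%:R * y1.
    rewrite -bM /cross_degX natr_sum mulr_suml; apply: eq_bigr => y _ /=.
    by case: (boolP ((x, y) \in B)) => [/BY ->|]; rewrite ?mul0r.
  rewrite gM /=; case: (x \in codom g) => /=; lra.
have eYY y : nbr_sum z (vY B y) = r * z (vY B y) + ((cross_degY B y)%:R - (y \in T)%:R) * a.
  rewrite nbr_sumY sW sY.
  have -> : \sum_x ((x, y) \in B)%:R * z (vX B x) = (cross_degY B y)%:R * a.
    rewrite /cross_degY natr_sum mulr_suml; apply: eq_bigr => x _ /=.
    by case: (boolP ((x, y) \in B)) => [/BX ->|]; rewrite ?mul0r.
  rewrite /=; case: (boolP (y \in T)) => yT /=; lra.
have dY : \sum_y z (vY B y) * (((cross_degY B y)%:R - (y \in T)%:R) * a) = 0.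
  rewrite (eq_bigr (fun y => y1 * a * ((cross_degY B y)%:R - (y \in T)%:R))) => [|y _] /=;
    last first.
    case: (boolP (y \in T)) => yT; first by rewrite mulrA mulrAC.
    suff -> : cross_degY B y = 0%N by rewrite subrr mul0r !mulr0.
    apply/eqP; rewrite -leqn0 leqNgt; apply: contra yT => y_gt0.
    by apply: (subsetP hitT); rewrite inE.
  rewrite -mulr_sumr sumrB -!natr_sum sum_cross_degY cB.
  by rewrite sum_mem_nat cT subrr mulr0.
have qz : qform z = r * sqnorm z.
  rewrite /qform /sqnorm !sum_G !mulrDr !mulr_sumr.
  congr (_ + (_ + _)).
  - by apply: eq_bigr => i _; rewrite eW'; ring.
  - by apply: eq_bigr => x _; rewrite eXX; ring.
  rewrite -[RHS]addr0 -[X in _ = _ + X]dY -big_split.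
  apply: eq_bigr => y _ /=; rewrite eYY /=; ring.
have [ray _ _] := rho_spectral R (vY B ys : L2_graph n k h B).
have ray' (y : L2_graph n k h B -> R) : qform y <= r * sqnorm y.
  apply: (le_trans (ray y)); rewrite ler_wpM2r // sumr_ge0 // => v _; exact: sqr_ge0.
have := rayleigh_max_eigen ray' qz (vY B ys); rewrite eYY => e.
have /eqP : ((cross_degY B ys)%:R - (ys \in T)%:R) * a = 0 by lra.
rewrite mulf_eq0 (gt_eqF a0) orbF subr_eq0 eqr_nat.
by move: coll; case: (ys \in T); case: cross_degY => [|[|?]].
Qed.
End Strict.

(** * Comparison within the family *)

(** The clique size that [rho_upper_bound] asks for, at [P = 2 k]: this [P] bounds
    both the number of vertices in [X] and their degrees into the clique. *)
Definition n_threshold (k : nat) : nat := 4 * k ^ 2 * (2 * k + 1) * (4 * k + 1).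

Lemma sum_sq_shift (T : finType) (w : nat) (d : T -> nat) :
  \sum_x (w + d x) ^ 2 = #|T| * w ^ 2 + 2 * w * (\sum_x d x) + \sum_x d x ^ 2.
Proof.
rewrite -sum_nat_const big_distrr -!big_split; apply: eq_bigr => x _ /=; nia.
Qed.

(** [d ^ 2 - d] is even: the resulting gap of two exceeds the error [1] that
    [rho_upper_bound] leaves in the numerator. *)
Lemma sum_le_sum_sq (T : finType) (d : T -> nat) (x : T) :
  1 < d x -> \sum_y d y + 2 <= \sum_y d y ^ 2.
Proof.
move=> dx; rewrite (bigD1 x) //= [leqRHS](bigD1 x) //= addnAC leq_add //; first nia.
by apply: leq_sum => y _; nia.
Qed.

Lemma exists_injection (A B : finType) : #|A| <= #|B| -> exists f : A -> B, injective f.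
Proof.
move=> le; exists (fun a => enum_val (widen_ord le (enum_rank a))) => a b.
by move=> /enum_val_inj /(congr1 val) /= /val_inj /enum_rank_inj.
Qed.

Section Comparison.
Local Open Scope ring_scope.
Variables (R : realType) (n k h : nat).
Hypotheses (k0 : (0 < k)%N) (hk : (h < k)%N) (hn : (n_threshold k + 2 * h + 2 <= n)%N).
Notation Y := 'I_(n - k - h - 1).

Let N_large : (n_threshold k <= (k - h - 1) + (n - k - h - 1))%N.
Proof. lia. Qed.

Let thr : (2 * k * (2 * k) ^ 2 <= n_threshold k)%N.
Proof. by rewrite /n_threshold; nia. Qed.

Let thr_k : (4 * k <= n_threshold k)%N.
Proof. by rewrite /n_threshold; nia. Qed.

Lemma sq_clique_degE (H : sgraph) (B : {set H * Y}) :
  sq_clique_deg R B = (\sum_x ((k - h - 1) + cross_degX B x) ^ 2)%:R.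
Proof. by rewrite natr_sum; apply: eq_bigr => x _; rewrite natrX. Qed.

Lemma sq_clique_deg_le (H : sgraph) (B : {set H * Y}) :
  #|H| = (2 * h + 2)%N -> #|B| = (2 * h)%N ->
  sq_clique_deg R B <= clique_size R n k h ^+ 2.
Proof.
move=> cH cB; rewrite sq_clique_degE -natrX ler_nat.
apply: (@leq_trans (2 * k * (2 * k) ^ 2)).
  apply: (@leq_trans (\sum_(x : H) (2 * k) ^ 2)).
    apply: leq_sum => x _; rewrite leq_exp2r //.
    have : (cross_degX B x <= 2 * h)%N by rewrite -cB -sum_cross_degX (bigD1 x) //= leq_addr.
    lia.
  by rewrite sum_nat_const cH leq_mul2r; apply/orP; right; lia.
apply: (leq_trans thr); apply: (leq_trans N_large).
by rewrite -{1}[X in (X <= _)%N]expn1 leq_pexp2l //; lia.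
Qed.

Variable f : pairs h -> Y.
Hypothesis f_inj : injective f.

Lemma rho_min_graph_ge1 (v0 : Y) : 1 <= rho R (min_graph f).
Proof.
have := rho_lower_bound v0 (sq_clique_deg_le (card_min_X h) (card_min_cross f)).
apply: le_trans.
have s0 : 0 <= sq_clique_deg R (min_cross f) / clique_size R n k h ^+ 2.
  by rewrite divr_ge0 ?exprn_ge0 ?ler0n // sq_clique_degE ler0n.
have : 2 <= clique_size R n k h by rewrite (ler_nat R 2); lia.
lra.
Qed.

(** Since [cross_degX = missing_deg] has sum [2 h], the sum of
    [(w + missing_deg x) ^ 2] depends on [H] only through the sum of the
    [missing_deg x ^ 2], which is [2 h] for a matching and at least [2 h + 2]
    otherwise. *)
Lemma strict_of_not_matching (H : sgraph) (B : {set H * Y}) (v0 : Y) (x : H) :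
  #|H| = (2 * h + 2)%N -> #|B| = (2 * h)%N -> (forall x, cross_degX B x = missing_deg x) ->
  (1 < missing_deg x)%N -> rho R (min_graph f) < rho R (L2_graph n k h B).
Proof.
move=> cH cB bM dx.
have lower := rho_lower_bound v0 (sq_clique_deg_le cH cB).
apply: lt_le_trans lower.
have N0 := clique_size_gt0 R v0.
have k1 : 1 <= k%:R :> R by rewrite (ler_nat R 1).
have upper : rho R (min_graph f) <=
    clique_size R n k h - 1 + (sq_clique_deg R (min_cross f) + 1) / clique_size R n k h ^+ 2.
  apply: (rho_upper_bound v0 (P := 2 * k%:R)).
  - lra.
  - by rewrite card_min_X -natrM ler_nat; lia.
  - move=> v; rewrite -natrM ler_nat cross_degX_min_cross.
    have [_ _ ->] := @min_X_labels h; case: (_ \in _) => /=; lia.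
  apply: (@le_trans _ _ (n_threshold k)%:R); last by rewrite ler_nat.
  by rewrite /n_threshold !(natrM, natrD, natrX) le_eqVlt; apply/orP; left; apply/eqP; ring.
apply: (le_lt_trans upper); rewrite ltrD2l ltr_pM2r ?invr_gt0 ?exprn_gt0 //.
rewrite !sq_clique_degE -(natrD _ _ 1) ltr_nat.
rewrite (eq_bigr (fun x => ((k - h - 1) + missing_deg x) ^ 2)%N);
  last by move=> v _; rewrite cross_degX_min_cross.
rewrite [ltnRHS](eq_bigr (fun x => ((k - h - 1) + missing_deg x) ^ 2)%N);
  last by move=> v _; rewrite bM.
have sB : (\sum_x missing_deg (x : H) = 2 * h)%N by rewrite -cB -sum_cross_degX; apply: eq_bigr.
rewrite !sum_sq_shift sB sum_missing_deg_min_X cH card_min_X -addnA ltn_add2l.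
apply: leq_trans (sum_le_sum_sq dx); rewrite sB.
rewrite (eq_bigr (fun x => missing_deg x)) ?sum_missing_deg_min_X; first lia.
by move=> v _; have [_ _ ->] := @min_X_labels h; case: (_ \in _).
Qed.

Lemma strict_or_minimal (H : sgraph) (B : {set H * Y}) (v0 : Y) :
  (2 * h <= n - k - h - 1)%N ->
  #|H| = (2 * h + 2)%N -> #|B| = (2 * h)%N -> (forall x, cross_degX B x = missing_deg x) ->
  (0 < h)%N /\ rho R (min_graph f) < rho R (L2_graph n k h B) \/
  [/\ iso (L2_graph n k h B) (min_graph f), iso (graph_compl H) (hK2_2K1 h)
    & {in B &, forall p q, p.2 = q.2 -> p = q}].
Proof.
move=> hm cH cB bM.
have sB : (\sum_x missing_deg (x : H) = 2 * h)%N by rewrite -cB -sum_cross_degX; apply: eq_bigr.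
case: (pickP (fun x : H => 1 < missing_deg x)%N) => [x dx|M1].
  left; split; last exact: (strict_of_not_matching v0 cH cB bM dx).
  have : (missing_deg x <= 2 * h)%N by rewrite -sB (bigD1 x) //= leq_addr.
  lia.
have {}M1 (x : H) : (missing_deg x <= 1)%N by rewrite leqNgt M1.
have [g gl] := matching_labelling cH sB M1.
case: (pickP (fun y => 1 < cross_degY B y)%N) => [y dy|Y1].
  left; have h0 : (0 < h)%N.
    have : (cross_degY B y <= 2 * h)%N by rewrite -cB -sum_cross_degY (bigD1 y) //= leq_addr.
    lia.
  split=> //.
  have [al [b' [b [y1 [y2 [q a0]]]]]] := min_graph_quotient v0 f_inj h0 (rho_min_graph_ge1 v0).
  exact: strict_of_collision cH hm gl bM cB q a0 dy.
right; have B_inj : {in B &, forall p q, p.2 = q.2 -> p = q}.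
  move=> [x y] [x' y'] xy x'y' /= yy; subst y'; congr (_, _).
  apply/eqP; apply: contraFT (Y1 y) => xx.
  by rewrite /cross_degY (bigD1 x) //= xy (bigD1 x') //= ?x'y' // eq_sym.
by have [] := min_graph_iso f_inj cH gl bM B_inj.
Qed.
End Comparison.

Theorem theorem1p4 (R : realType) (k delta : nat)
    (hk : 2 <= k) (hdelta : k <= delta <= 2 * k - 1) :
  exists n_int : nat, 2 * delta + 2 <= n_int /\
  forall n : nat, n_int <= n ->
  exists Gmin : sgraph,
    [/\ L2 n k delta Gmin,
        forall G : sgraph, L2 n k delta G ->
          (rho R Gmin <= rho R G)%R /\ (rho R G = rho R Gmin <-> iso G Gmin),
        forall G : sgraph, L2 n k delta G ->
          ((forall G' : sgraph, L2 n k delta G' -> (rho R G <= rho R G')%R) <->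
           iso G Gmin),
        delta - k = 0 ->
          exists Gstar : sgraph,
            [/\ L2 n k k Gstar,
                forall G : sgraph, L2 n k k G -> iso G Gstar
              & iso Gmin Gstar]
      & 1 <= delta - k ->
          forall (H : sgraph) (B : {set H * 'I_(n - k - (delta - k) - 1)}),
            L2_data n k delta B -> iso Gmin (L2_graph n k (delta - k) B) ->
            iso (graph_compl H) (hK2_2K1 (delta - k)) /\
            {in B &, forall p q, p.2 = q.2 -> p = q}].
Proof.
exists (n_threshold k + 2 * delta + 2); split; first lia.
move=> n hn; set h := delta - k.
have k0 : 0 < k by lia.
have hk' : h < k by rewrite /h; lia.
have hn' : n_threshold k + 2 * h + 2 <= n by rewrite /h; lia.
have thr : 4 * k <= n_threshold k by rewrite /n_threshold; nia.
have hm : 2 * h <= n - k - h - 1 by lia.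
have v0 : 'I_(n - k - h - 1) by apply: (@Ordinal _ 0); lia.
have [f f_inj] : exists f : pairs h -> 'I_(n - k - h - 1), injective f.
  by apply: exists_injection; rewrite card_prod !card_ord mulnC.
have fam : L2 n k delta (min_graph f).
  exists (min_X h), (min_cross f); split; last by exists id => //; exists id.
  split; [exact: card_min_X | exact: connected_min_X | exact: card_edges_min_X
         | exact: card_min_cross | exact: min_graph_degrees].
have dich (H : sgraph) (B : {set H * 'I_(n - k - h - 1)}) : L2_data n k delta B ->
    (0 < h) /\ (rho R (min_graph f) < rho R (L2_graph n k h B))%R \/
    [/\ iso (L2_graph n k h B) (min_graph f), iso (graph_compl H) (hK2_2K1 h)
      & {in B &, forall p q, p.2 = q.2 -> p = q}].
  move=> data; have [bM _] := L2_degrees hdelta k0 data.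
  by case: data => cH _ _ cB _; apply: strict_or_minimal.
have key G : L2 n k delta G -> 0 < h /\ (rho R (min_graph f) < rho R G)%R \/ iso G (min_graph f).
  move=> [H [B [data GB]]].
  have vB : L2_graph n k h B := inr (inr v0).
  have [[hpos lt]|[BG _ _]] := dich H B data; [left | right; exact: iso_trans GB BG].
  by split=> //; rewrite -(rho_iso R vB (iso_sym GB)).
have vmin : min_graph f := inr (inr v0).
have rhoE G : iso G (min_graph f) -> rho R G = rho R (min_graph f).
  by move=> /iso_sym/(rho_iso R vmin).
exists (min_graph f); split=> //.
- move=> G /key[[hpos lt]|GG]; last by rewrite (rhoE G GG).
  split; first exact: ltW.
  by split=> [E|/rhoE //]; rewrite E ltxx in lt.
- move=> G GL; split=> [min|GG G' /key[[hpos lt]|/rhoE ->]].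
  + by case: (key G GL) => // -[_ lt]; have := min _ fam; rewrite leNgt lt.
  + by rewrite (rhoE G GG) ltW.
  by rewrite (rhoE G GG).
- move=> h0; exists (min_graph f).
  have dk : delta = k by lia.
  split; [by have := fam; rewrite dk | move=> G GL | by exists id => //; exists id].
  have /key[[]|//] : L2 n k delta G by rewrite dk.
  by move=> hpos; have := hpos; rewrite {1}h0.
move=> _ H B data GB; have [[_ lt]|[]//] := dich H B data.
by rewrite (rho_iso R vmin GB) ltxx in lt.
Qed.
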